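(* For every composition $\alpha \vDash n$ we have $K^{\mathfrak{L}}_{\alpha, \alpha}=1$, and for every composition $\beta\vDash n$ with $\alpha <_{\ell} \beta$ (i.e. $\alpha \le_\ell \beta$ and $\alpha\neq\beta$) we have $K^{\mathfrak{L}}_{\alpha, \beta}=0$.
   Context: A composition $\alpha \vDash n$ is a tuple of positive integers summing to $n$; its diagram has left-justified rows, row $i$ (from the bottom) having $\alpha_i$ cells. The lexicographic order $\le_\ell$ on compositions: $\alpha <_\ell \beta$ if there is $j$ with $\alpha_i=\beta_i$ for all $i<j$ and $\alpha_j<\beta_j$. A word is a necklace word if it is lexicographically weakly smallest among all its cyclic shifts. A lexical tableau of shape $\alpha$ and type $\beta$ is a filling of the diagram of $\alpha$ with positive integers in which $i$ appears exactly $\beta_i$ times, the first column strictly increases from the bottom row upward, and every row read left to right is a necklace word. $K^{\mathfrak{L}}_{\alpha,\beta}$ is the number of lexical tableaux of shape $\alpha$ and type $\beta$. *)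

(* Defs.v *)
From mathcomp Require Import all_boot all_order.

Set Implicit Arguments.
Unset Strict Implicit.
Unset Printing Implicit Defensive.

Import Order.TTheory.

Definition is_composition (n : nat) (a : seq nat) : bool :=
  all (fun x => 0 < x) a && (sumn a == n).

(* Parts are 0-indexed. Both indices must exist, so a proper prefix is not
   smaller; this case never arises between compositions of the same n. *)
Definition lex_lt (a b : seq nat) : Prop :=
  exists j, [/\ j < size a, j < size b,
    (forall i, i < j -> nth 0 a i = nth 0 b i) & nth 0 a j < nth 0 b j].

(* rot k w, for k < size w, are all the cyclic shifts of w; seqlexi is the
   lexicographic order on words. *)
Definition necklace_word (w : seq nat) : bool :=
  all (fun k => (w <= rot k w :> seqlexi nat)%O) (iota 0 (size w)).

(* A filling is the sequence of its rows, from the bottom row upward. *)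
Record lexical_tableau (alpha beta : seq nat) (T : seq (seq nat)) : Prop :=
  LexicalTableau {
    lexical_shape : shape T = alpha;
    lexical_positive : forall x, x \in flatten T -> 0 < x;
    (* Beyond the last part of beta, nth returns 0. *)
    lexical_type :
      forall i, 0 < i -> count_mem i (flatten T) = nth 0 beta i.-1;
    lexical_column : sorted ltn [seq head 0 r | r <- T];
    lexical_rows : forall r, r \in T -> necklace_word r
  }.

(* The word 1^(beta_1) 2^(beta_2) ... *)
Definition type_word (beta : seq nat) : seq nat :=
  flatten [seq nseq (nth 0 beta i) i.+1 | i <- iota 0 (size beta)].

(* The lexical tableaux as a finite list: cut each rearrangement of type_word
   beta into rows of lengths alpha. See lexical_tableauxP and
   lexical_tableaux_uniq. *)
Definition lexical_tableaux (alpha beta : seq nat) : seq (seq (seq nat)) :=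
  [seq T <- [seq reshape alpha w | w <- permutations (type_word beta)
                                 & size w == sumn alpha]
     | sorted ltn [seq head 0 r | r <- T] && all necklace_word T].

Definition lexical_kostka (alpha beta : seq nat) : nat :=
  size (lexical_tableaux alpha beta).

Lemma count_type_word beta x :
  count_mem x (type_word beta) = if x is i.+1 then nth 0 beta i else 0.
Proof.
rewrite /type_word count_flatten -map_comp.
rewrite (eq_map (g := fun i => (i.+1 == x) * nth 0 beta i)); last first.
  by move=> i /=; rewrite count_nseq.
rewrite sumnE big_map; case: x => [|x]; first by rewrite big1.
under eq_bigr => i _ do rewrite eqSS.
case: (ltnP x (size beta)) => xb; last first.
  rewrite nth_default // big_seq big1 // => i; rewrite mem_iota /= add0n => ib.
  by rewrite ltn_eqF // (leq_trans ib).
rewrite (bigD1_seq x) ?mem_iota ?iota_uniq //= eqxx mul1n big1 ?addn0 //.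
by move=> i /negbTE ->.
Qed.

Lemma perm_type_wordP beta w :
  perm_eq w (type_word beta) <->
  (forall x, x \in w -> 0 < x) /\
  (forall i, 0 < i -> count_mem i w = nth 0 beta i.-1).
Proof.
split=> [/permP wb | [wpos wtype]].
  split=> [x|[//|i] _]; last by rewrite wb count_type_word.
  by case: x => //; rewrite -has_pred1 has_count wb count_type_word.
apply/allP=> x _ /=; rewrite count_type_word; case: x => [|x].
  by apply/eqP/count_memPn/negP => /wpos.
by rewrite wtype.
Qed.

Lemma lexical_tableauxP alpha beta T :
  T \in lexical_tableaux alpha beta <-> lexical_tableau alpha beta T.
Proof.
rewrite mem_filter; split.
  case/andP=> /andP[col /allP rows] /mapP[w].
  rewrite mem_filter mem_permutations => /andP[/eqP sw wb] defT.
  have Tw : flatten T = w by rewrite defT reshapeKr // sw.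
  have [wpos wtype] := (perm_type_wordP beta w).1 wb.
  by split; rewrite ?Tw // defT reshapeKl // sw.
case=> sh Tpos Ttype col rows; rewrite col /=; apply/andP; split.
  by apply/allP.
apply/mapP; exists (flatten T); last by rewrite -sh flattenK.
rewrite mem_filter mem_permutations size_flatten sh eqxx /=.
exact/perm_type_wordP.
Qed.

Lemma lexical_tableaux_uniq alpha beta : uniq (lexical_tableaux alpha beta).
Proof.
rewrite filter_uniq // map_inj_in_uniq ?filter_uniq ?permutations_uniq //.
move=> u v; rewrite !mem_filter => /andP[/eqP su _] /andP[/eqP sv _] uv.
by rewrite -(@reshapeKr _ alpha u) ?su // uv reshapeKr ?sv.
Qed.

(* Main.v *)
(** The first entry of a necklace word is its minimum, so in a lexical tableau
    row [i] (counted from 0) only has entries at least [i + 1], and the entry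
    [i + 1] occurs in no row above row [i]. Going up from the bottom, as long as
    [alpha] and [beta] agree, each row [i] must consist of [alpha_i] copies of
    [i + 1]; the first row where they differ cannot hold more than [alpha_i]
    copies of [i + 1], hence [beta_i < alpha_i] there. *)
Require Import Defs.
From mathcomp Require Import all_boot all_order.

Set Implicit Arguments.
Unset Strict Implicit.
Unset Printing Implicit Defensive.

Import Order.TTheory.

Lemma lex_lt_cons a b s t :
  lex_lt (a :: s) (b :: t) -> a < b \/ a = b /\ lex_lt s t.
Proof.
case=> -[|j] [sj tj eqj ltj]; first by left.
right; split; first exact: (eqj 0).
by exists j; split=> // i ij; apply: (eqj i.+1).
Qed.

Lemma lex_lt_nil_l t : ~ lex_lt [::] t.
Proof. by case=> j []. Qed.

Lemma lex_lt_nil_r s : ~ lex_lt s [::].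
Proof. by case=> j []. Qed.

(** Compare the first letters of [w] and of its rotation that starts at an occurrence of [x]. *)
Lemma necklace_word_head_le w x : necklace_word w -> x \in w -> head 0 w <= x.
Proof.
move=> /allP w_min wx; have lt_x_w : index x w < size w by rewrite index_mem.
have /w_min : index x w \in iota 0 (size w) by rewrite mem_iota.
rewrite /rot (drop_nth 0) // nth_index //; case: w {w_min wx lt_x_w} => //= y w.
by rewrite lexi_cons leEnat => /andP[].
Qed.

Lemma necklace_word_nseq k x : necklace_word (nseq k x).
Proof.
apply/allP => i; rewrite size_nseq mem_iota add0n => /andP[_ /ltnW le_ik].
by rewrite /rot drop_nseq take_nseq // -nseqD subnK.
Qed.

(* A lexical tableau remains one, up to the shift [m] of its entries, when its
   bottom rows are removed. *)
Record shifted_tableau (m : nat) (beta : seq nat) (T : seq (seq nat)) : Prop :=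
  ShiftedTableau {
    shifted_gt : forall x, x \in flatten T -> m < x;
    shifted_type : forall i, count_mem (m + i).+1 (flatten T) = nth 0 beta i;
    shifted_column : sorted ltn [seq head 0 r | r <- T];
    shifted_rows : forall r, r \in T -> necklace_word r;
    shifted_nonempty : forall r, r \in T -> 0 < size r
  }.

Lemma lexical_shifted_tableau alpha beta T :
  all (fun x => 0 < x) alpha -> lexical_tableau alpha beta T ->
  shifted_tableau 0 beta T.
Proof.
move=> /allP alpha_gt0 [shT T_gt0 typeT colT rowsT]; split=> // [i|r rT].
  by rewrite add0n typeT.
by apply: alpha_gt0; rewrite -shT map_f.
Qed.

Section BottomRow.

Variables (m b : nat) (beta : seq nat) (r : seq nat) (T : seq (seq nat)).
Hypothesis tabT : shifted_tableau m (b :: beta) (r :: T).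

(** If [x] lies in the row [s], then [m < head 0 r < head 0 s <= x]: the first column increases and
    a necklace word starts with its minimum. *)
Lemma shifted_upper_gt x : x \in flatten T -> m.+1 < x.
Proof.
case: tabT => gtT _ colT rowsT neT /flattenP[s sT xs].
(* As [r] is nonempty, its head is a genuine entry and not the default [0]. *)
have lt_m_r : m < head 0 r.
  apply: gtT; rewrite mem_cat; apply/orP; left.
  by have := neT r (mem_head _ _); case: (r) => //= y t _; rewrite mem_head.
have lt_r_s : head 0 r < head 0 s.
  move: colT; rewrite /= path_sortedE; last exact: ltn_trans.
  by case/andP=> /allP heads_gt _; apply: heads_gt; rewrite map_f.
apply: leq_trans (leq_trans _ lt_r_s) (necklace_word_head_le _ xs) => //.
by apply: rowsT; rewrite in_cons sT orbT.
Qed.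

(** The rows above hold only larger entries, so every copy of [m.+1] lies in [r]. *)
Lemma shifted_bottom_count : count_mem m.+1 r = b.
Proof.
have := shifted_type tabT 0; rewrite addn0 /= count_cat => <-.
rewrite [X in _ + X](_ : _ = 0) ?addn0 //.
by apply/count_memPn/negP => /shifted_upper_gt; rewrite ltnn.
Qed.

Lemma shifted_bottom_le : b <= size r.
Proof. by rewrite -shifted_bottom_count count_size. Qed.

Hypothesis size_r : size r = b.

Lemma shifted_bottom_eq : r = nseq b m.+1.
Proof.
rewrite -size_r; apply/all_pred1P.
by rewrite all_count shifted_bottom_count size_r.
Qed.

Lemma shifted_upper : shifted_tableau m.+1 beta T.
Proof.
case: tabT => _ typeT colT rowsT neT; split.
- exact: shifted_upper_gt.
(* The removed row holds only [m.+1], so it adds nothing to the count of a larger entry. *)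
- move=> i; have /= <- := typeT i.+1.
  rewrite count_cat shifted_bottom_eq count_nseq addSnnS /=.
  by rewrite eqSS ltn_eqF ?mul0n // -[X in X < _]addn0 ltn_add2l.
- exact: path_sorted colT.
- by move=> s sT; apply: rowsT; rewrite in_cons sT orbT.
- by move=> s sT; apply: neT; rewrite in_cons sT orbT.
Qed.

End BottomRow.

Lemma shifted_not_lex_lt m beta T :
  shifted_tableau m beta T -> ~ lex_lt (shape T) beta.
Proof.
elim: T m beta => [|r T IHT] m [|b beta] tabT; try exact: lex_lt_nil_l.
  exact: lex_lt_nil_r.
case/lex_lt_cons=> [|[size_r]]; first by rewrite ltnNge (shifted_bottom_le tabT).
exact: IHT (shifted_upper tabT size_r).
Qed.

(** For [m = 0] this is the unique lexical tableau of shape and type [alpha]; the offset [m] serves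
    the induction that removes bottom rows. *)
Definition constant_rows (m : nat) (alpha : seq nat) : seq (seq nat) :=
  [seq nseq (nth 0 alpha i) (m + i).+1 | i <- iota 0 (size alpha)].

Lemma constant_rows_cons m a alpha :
  constant_rows m (a :: alpha) = nseq a m.+1 :: constant_rows m.+1 alpha.
Proof.
rewrite /constant_rows /= addn0 (iotaDl 1 0) -map_comp; congr (_ :: _).
by apply: eq_map => i /=; rewrite add1n addnS.
Qed.

Lemma shape_constant_rows m alpha : shape (constant_rows m alpha) = alpha.
Proof.
elim: alpha m => // a alpha IH m.
by rewrite constant_rows_cons /= size_nseq IH.
Qed.

Lemma shifted_eq_constant_rows m T :
  shifted_tableau m (shape T) T -> T = constant_rows m (shape T).
Proof.
elim: T m => // r T IHT m tabT; rewrite [shape _]/= constant_rows_cons.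
by rewrite -(shifted_bottom_eq tabT) // -IHT //; apply: shifted_upper tabT _.
Qed.

Lemma constant_rows_lexical alpha :
  all (fun x => 0 < x) alpha -> lexical_tableau alpha alpha (constant_rows 0 alpha).
Proof.
move=> /all_nthP alpha_gt0.
(* [flatten (constant_rows 0 alpha)] is convertible to [type_word alpha], which settles positivity
   and type. *)
have [gt0 type] := (perm_type_wordP alpha _).1 (perm_refl (type_word alpha)).
split=> //; first exact: shape_constant_rows; last first.
  by move=> r /mapP[i _ ->]; apply: necklace_word_nseq.
(* Parts being positive, row [i] really starts with [i.+1], so the first column is 1, 2, 3 and so
   on. *)
rewrite -map_comp; have /eq_in_map -> : {in iota 0 (size alpha),
    (head 0 \o fun i => nseq (nth 0 alpha i) i.+1) =1 succn}.
  move=> i; rewrite mem_iota add0n /= => /(alpha_gt0 0).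
  by case: (nth 0 alpha i).
by rewrite sorted_map; apply: iota_ltn_sorted.
Qed.

Theorem theorem3p8 (n : nat) (alpha : seq nat)
    (halpha : is_composition n alpha) :
  lexical_kostka alpha alpha = 1 /\
  (forall beta : seq nat, is_composition n beta -> lex_lt alpha beta ->
     lexical_kostka alpha beta = 0).
Proof.
have /andP[alpha_gt0 _] := halpha; rewrite /lexical_kostka; split.
  (* Two duplicate-free lists with the same members have the same size. *)
  rewrite -[1]/(size [:: constant_rows 0 alpha]); apply/perm_size.
  apply: uniq_perm => // [|T]; first exact: lexical_tableaux_uniq.
  rewrite inE; apply/idP/eqP => [/lexical_tableauxP tabT|->]; last first.
    exact/lexical_tableauxP/constant_rows_lexical.
  have shT := lexical_shape tabT; rewrite -shT.
  by apply: shifted_eq_constant_rows; rewrite shT; apply: lexical_shifted_tableau tabT.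
move=> beta _ lt_ab; case defL: (lexical_tableaux _ _) => [//|T L].
have /lexical_tableauxP tabT : T \in lexical_tableaux alpha beta.
  by rewrite defL mem_head.
case: (shifted_not_lex_lt (lexical_shifted_tableau alpha_gt0 tabT)).
by rewrite (lexical_shape tabT).
Qed.
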